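(* Let $U\subseteq\mathbb H$ be an axially symmetric open set, let $f$ be a left slice hyperholomorphic function on $U$, and let $p\in U$. Assume that $f$ admits the $*$-Taylor expansion $$f(q)=\sum_{n=0}^\infty(q-p)^{*n}a_n,\qquad a_n\in\mathbb H,$$ convergent absolutely and uniformly on the compact subsets of $\Omega(p,R)\subseteq U$, where $\frac1R=\limsup_{n\to\infty}|a_n|^{1/n}$, $R>0$. Then $$\bar Df(q)=\sum_{n=0}^\infty\widetilde P_{2,n}(q,p)\,b_n,\qquad q\in\Omega(p,R),\qquad b_n:=2(n+1)a_{n+1}.$$
   Context: $\mathbb H$ denotes the quaternions $q=q_0+q_1e_1+q_2e_2+q_3e_3$ with the usual relations ($e_i^2=-1$, $e_1e_2=-e_2e_1=e_3$, $e_2e_3=-e_3e_2=e_1$, $e_3e_1=-e_1e_3=e_2$), $\underline q=q_1e_1+q_2e_2+q_3e_3$, $\bar q=q_0-\underline q$, $\mathbb S=\{\underline q:|\underline q|=1\}$, $\mathbb C_I=\mathbb R+I\mathbb R$ for $I\in\mathbb S$, $[q]=\{q_0+I|\underline q|:I\in\mathbb S\}$; a set $U$ is axially symmetric if $[q]\subset U$ for all $q\in U$. Slice hyperholomorphic: for $U$ axially symmetric open and $\mathcal U=\{(u,v)\in\mathbb R^2:u+\mathbb Sv\subset U\}$, $f:U\to\mathbb H$ is left slice hyperholomorphic if $f(u+Iv)=\alpha(u,v)+I\beta(u,v)$ for all $(u,v)\in\mathcal U$, $I\in\mathbb S$, with $C^1$ functions $\alpha,\beta:\mathcal U\to\mathbb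 H$, $\alpha$ even and $\beta$ odd in $v$, satisfying $\partial_u\alpha=\partial_v\beta$, $\partial_v\alpha=-\partial_u\beta$. $\bar D=\partial_{q_0}-e_1\partial_{q_1}-e_2\partial_{q_2}-e_3\partial_{q_3}$ acting from the left, in $q$. $\Omega(p,R)$: choose $I\in\mathbb S$ with $p\in\mathbb C_I$ and let $D_I(p,R)=\{z\in\mathbb C_I:|z-p|<R\}$; then $\Omega(p,R)=\{x+Jy:J\in\mathbb S,\ x,y\in\mathbb R,\ x+yI\in D_I(p,R)\text{ and }x-yI\in D_I(p,R)\}$. $*$-powers and products (left $*$-product in $q$): $(q-p)^{*m}=\sum_{i=0}^m\binom mi q^i(-p)^{m-i}$, $(\bar q-p)^{*k}=\sum_{j=0}^k\binom kj\bar q^j(-p)^{k-j}$, $(q-p)^{*m}*(\bar q-p)^{*k}=\sum_{i=0}^m\sum_{j=0}^k\binom mi\binom kj q^i\bar q^j(-p)^{m-i+k-j}$. $$\widetilde P_{2,n}(q,p)=(q-p)^{*n}+\frac1{n+1}\sum_{k=1}^{n+1}(q-p)^{*(n+1-k)}*(\bar q-p)^{*(k-1)},\quad n\ge0.$$ *)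

(* Defs.v *)
From HB Require Import structures.
From mathcomp Require Import all_boot all_order all_algebra.
From mathcomp Require Import ring lra.
From mathcomp Require Import all_classical all_reals all_analysis.

Set Implicit Arguments.
Unset Strict Implicit.
Unset Printing Implicit Defensive.

Import Order.TTheory GRing.Theory Num.Theory.
Import numFieldNormedType.Exports.

Local Open Scope classical_set_scope.
Local Open Scope ring_scope.

Record quat (R : realType) := Quat { q0 : R; q1 : R; q2 : R; q3 : R }.

Section QuatStructures.
Variable R : realType.
Implicit Types (p q r : quat R) (c : R).

Let to_prod q := (q0 q, q1 q, q2 q, q3 q).
Let of_prod (t : R * R * R * R) :=
  let: (a, b, c, d) := t in Quat a b c d.

Let to_prodK : cancel to_prod of_prod. Proof. by case. Qed.

HB.instance Definition _ := Choice.copy (quat R) (can_type to_prodK).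

Definition quat_add p q :=
  Quat (q0 p + q0 q) (q1 p + q1 q) (q2 p + q2 q) (q3 p + q3 q).
Definition quat_opp q := Quat (- q0 q) (- q1 q) (- q2 q) (- q3 q).
Definition quat_zero : quat R := Quat 0 0 0 0.

Let quat_addA : associative quat_add.
Proof. by move=> [? ? ? ?] [? ? ? ?] [? ? ? ?]; rewrite /quat_add /= !addrA. Qed.
Let quat_addC : commutative quat_add.
Proof.
move=> [a b c d] [a' b' c' d']; rewrite /quat_add /=.
by congr Quat; exact: addrC.
Qed.
Let quat_add0 : left_id quat_zero quat_add.
Proof. by move=> [? ? ? ?]; rewrite /quat_add /= !add0r. Qed.
Let quat_addN : left_inverse quat_zero quat_opp quat_add.
Proof. by move=> [? ? ? ?]; rewrite /quat_add /= !addNr. Qed.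

HB.instance Definition _ :=
  GRing.isZmodule.Build (quat R) quat_addA quat_addC quat_add0 quat_addN.

Definition quat_one : quat R := Quat 1 0 0 0.
Definition quat_mul p q := Quat
  (q0 p * q0 q - q1 p * q1 q - q2 p * q2 q - q3 p * q3 q)
  (q0 p * q1 q + q1 p * q0 q + q2 p * q3 q - q3 p * q2 q)
  (q0 p * q2 q - q1 p * q3 q + q2 p * q0 q + q3 p * q1 q)
  (q0 p * q3 q + q1 p * q2 q - q2 p * q1 q + q3 p * q0 q).

Let quat_mulA : associative quat_mul.
Proof.
by move=> [? ? ? ?] [? ? ? ?] [? ? ? ?]; rewrite /quat_mul /=; congr Quat; ring.
Qed.
Let quat_mul1l : left_id quat_one quat_mul.
Proof. by move=> [? ? ? ?]; rewrite /quat_mul /=; congr Quat; ring. Qed.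
Let quat_mul1r : right_id quat_one quat_mul.
Proof. by move=> [? ? ? ?]; rewrite /quat_mul /=; congr Quat; ring. Qed.
Let quat_mulDl : left_distributive quat_mul +%R.
Proof.
by move=> [? ? ? ?] [? ? ? ?] [? ? ? ?]; rewrite /quat_mul /=; congr Quat;
  rewrite /=; ring.
Qed.
Let quat_mulDr : right_distributive quat_mul +%R.
Proof.
by move=> [? ? ? ?] [? ? ? ?] [? ? ? ?]; rewrite /quat_mul /=; congr Quat;
  rewrite /=; ring.
Qed.
Let quat_one_neq0 : quat_one != 0.
Proof. by apply/eqP => -[] /eqP; rewrite oner_eq0. Qed.

HB.instance Definition _ := GRing.Zmodule_isNzRing.Build (quat R)
  quat_mulA quat_mul1l quat_mul1r quat_mulDl quat_mulDr quat_one_neq0.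

Definition quat_scale c q := Quat (c * q0 q) (c * q1 q) (c * q2 q) (c * q3 q).

Let quat_scaleA a b q : quat_scale a (quat_scale b q) = quat_scale (a * b) q.
Proof. by rewrite /quat_scale /= !mulrA. Qed.
Let quat_scale1 : left_id 1 quat_scale.
Proof. by move=> [? ? ? ?]; rewrite /quat_scale /= !mul1r. Qed.
Let quat_scaleDr : right_distributive quat_scale +%R.
Proof. by move=> c [? ? ? ?] [? ? ? ?]; congr Quat; rewrite /= mulrDr. Qed.
Let quat_scaleDl q : {morph quat_scale^~ q : a b / a + b}.
Proof. by move=> a b; congr Quat; rewrite /= mulrDl. Qed.

HB.instance Definition _ := GRing.Zmodule_isLmodule.Build R (quat R)
  quat_scaleA quat_scale1 quat_scaleDr quat_scaleDl.

Let quat_scaleAl c p q : c *: (p * q) = c *: p * q.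
Proof. by case: p q => [? ? ? ?] [? ? ? ?]; congr Quat; rewrite /=; ring. Qed.
HB.instance Definition _ :=
  GRing.Lmodule_isLalgebra.Build R (quat R) quat_scaleAl.

Let quat_scaleAr c p q : c *: (p * q) = p * (c *: q).
Proof. by case: p q => [? ? ? ?] [? ? ? ?]; congr Quat; rewrite /=; ring. Qed.
HB.instance Definition _ :=
  GRing.Lalgebra_isAlgebra.Build R (quat R) quat_scaleAr.

Definition quat_norm q : R :=
  Num.sqrt (q0 q ^+ 2 + q1 q ^+ 2 + q2 q ^+ 2 + q3 q ^+ 2).

Let sumsq_ge0 (a b c d : R) : 0 <= a ^+ 2 + b ^+ 2 + c ^+ 2 + d ^+ 2.
Proof. by rewrite !addr_ge0 // sqr_ge0. Qed.

Let quat_normD p q : quat_norm (p + q) <= quat_norm p + quat_norm q.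
Proof.
case: p q => [a b c d] [x y z t]; rewrite /quat_norm /=.
set A := a ^+ 2 + _ + _ + _; set B := x ^+ 2 + _ + _ + _.
have A0 : 0 <= A by exact: sumsq_ge0.
have B0 : 0 <= B by exact: sumsq_ge0.
have CS : a * x + b * y + c * z + d * t <= Num.sqrt A * Num.sqrt B.
  rewrite -sqrtrM //; apply: (le_trans (ler_norm _)).
  rewrite -sqrtr_sqr ler_sqrt ?mulr_ge0 // -subr_ge0.
  have -> : A * B - (a * x + b * y + c * z + d * t) ^+ 2 =
    (a * y - b * x) ^+ 2 + (a * z - c * x) ^+ 2 + (a * t - d * x) ^+ 2
    + (b * z - c * y) ^+ 2 + ((b * t - d * y) ^+ 2 + (c * t - d * z) ^+ 2).
    by rewrite /A /B; ring.
  by rewrite !addr_ge0 // sqr_ge0.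
rewrite -[leRHS]ger0_norm ?addr_ge0 ?sqrtr_ge0 // -sqrtr_sqr.
rewrite ler_sqrt ?sqr_ge0 // (sqrrD (Num.sqrt A)) !sqr_sqrtr //.
have -> : (a + x) ^+ 2 + (b + y) ^+ 2 + (c + z) ^+ 2 + (d + t) ^+ 2 =
  A + B + (a * x + b * y + c * z + d * t) *+ 2 by rewrite /A /B; ring.
by rewrite addrAC lerD2r lerD2l lerMn2r CS orbT.
Qed.

Let quat_normZ c q : quat_norm (c *: q) = `|c| * quat_norm q.
Proof.
rewrite /quat_norm /= -sqrtr_sqr -sqrtrM ?sqr_ge0 //; congr Num.sqrt.
by rewrite !exprMn !mulrDr.
Qed.

Let quat_norm0_eq0 q : quat_norm q = 0 -> q = 0.
Proof.
case: q => a b c d /eqP; rewrite /quat_norm /= sqrtr_eq0 => le0.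
have /eqP : a ^+ 2 + b ^+ 2 + c ^+ 2 + d ^+ 2 = 0.
  by apply/eqP; rewrite eq_le le0 sumsq_ge0.
rewrite !paddr_eq0 ?addr_ge0 ?sqr_ge0 // !sqrf_eq0.
by move=> /andP[/andP[/andP[/eqP-> /eqP->] /eqP->] /eqP->].
Qed.

(* On [quat R], [`|q|] is the Euclidean norm and the topology is the one it
   induces, so that [open], [compact], ['D_v f] have their usual meaning. *)
HB.instance Definition _ :=
  Lmodule_isNormed.Build R (quat R) quat_normD quat_normZ quat_norm0_eq0.

End QuatStructures.

Section SliceHyperholomorphic.
Variable R : realType.
Local Notation H := (quat R).
Implicit Types (p q : H) (U : set H).

Definition e1 : H := Quat 0 1 0 0.
Definition e2 : H := Quat 0 0 1 0.
Definition e3 : H := Quat 0 0 0 1.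

Definition qvec q : H := Quat 0 (q1 q) (q2 q) (q3 q).
Definition qconj q : H := (q0 q)%:A - qvec q.

Definition imag_sphere : set H := [set I | q0 I = 0 /\ `|I| = 1].

Definition slice (I : H) : set H :=
  [set q | exists x y : R, q = x%:A + y *: I].

Definition axial_sphere q : set H :=
  [set r | exists2 I, imag_sphere I & r = (q0 q)%:A + `|qvec q| *: I].

Definition axially_symmetric U := forall q, U q -> axial_sphere q `<=` U.

Definition slice_domain U : set (R * R) :=
  [set w | forall I, imag_sphere I -> U (w.1%:A + w.2 *: I)].

Definition du (g : R * R -> H) (w : R * R) : H :=
  derive1 (fun s : R => g (s, w.2)) w.1.
Definition dv (g : R * R -> H) (w : R * R) : H :=
  derive1 (fun t : R => g (w.1, t)) w.2.

(* Meant for an open [V]: continuity of the partial derivatives at a point of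
   [V] then only involves points of [V]. *)
Definition C1_on (V : set (R * R)) (g : R * R -> H) :=
  forall w, V w ->
  [/\ derivable (fun s : R => g (s, w.2)) w.1 1,
      derivable (fun t : R => g (w.1, t)) w.2 1,
      {for w, continuous (du g)} & {for w, continuous (dv g)}].

(* Functions on [U] are total functions whose values off [U] are irrelevant. *)
Definition left_slice_hyperholomorphic U (f : H -> H) :=
  exists alpha beta : R * R -> H,
  [/\ forall w I, slice_domain U w -> imag_sphere I ->
        f (w.1%:A + w.2 *: I) = alpha w + I * beta w,
      C1_on (slice_domain U) alpha /\ C1_on (slice_domain U) beta,
      forall u v, slice_domain U (u, v) ->
        alpha (u, - v) = alpha (u, v) /\ beta (u, - v) = - beta (u, v)
    & forall w, slice_domain U w ->
        du alpha w = dv beta w /\ dv alpha w = - du beta w].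

Definition Dbar (f : H -> H) q : H :=
  'D_(1 : H) f q - e1 * 'D_e1 f q - e2 * 'D_e2 f q - e3 * 'D_e3 f q.

(* ['D_v f q] has a default value when the derivative does not exist; this
   says that all the partial derivatives in [Dbar f q] do exist. *)
Definition has_partials (f : H -> H) q :=
  [/\ derivable f q (1 : H), derivable f q e1,
      derivable f q e2 & derivable f q e3].

Definition slice_disc (I : H) p (r : \bar R) : set H :=
  [set z | slice I z /\ (`|z - p|%:E < r)%E].

(* [I] is determined by [p] up to sign when [p] is not real and is arbitrary
   when [p] is real; the set does not depend on it. *)
Definition Omega p (r : \bar R) : set H :=
  [set q | exists I J : H, exists x y : R,
    [/\ imag_sphere I /\ slice I p, imag_sphere J, q = x%:A + y *: J,
        slice_disc I p r (x%:A + y *: I) & slice_disc I p r (x%:A - y *: I)]].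

(* [star_pow n q p] is (q - p)^{*n}; [star_mul m k q p] is
   (q - p)^{*m} * (qconj q - p)^{*k}. *)
Definition star_pow n q p : H :=
  \sum_(0 <= i < n.+1) (q ^+ i * (- p) ^+ (n - i)) *+ 'C(n, i).

Definition star_mul m k q p : H :=
  \sum_(0 <= i < m.+1) \sum_(0 <= j < k.+1)
    (q ^+ i * qconj q ^+ j * (- p) ^+ (m - i + (k - j)))
      *+ ('C(m, i) * 'C(k, j)).

Definition P2 n q p : H :=
  star_pow n q p +
  n.+1%:R^-1 *: \sum_(1 <= k < n.+2) star_mul (n.+1 - k) k.-1 q p.

Definition star_taylor_expansion (f : H -> H) p (r : \bar R) (a : nat -> H) :=
  (forall q, Omega p r q ->
     cvgn (series (fun n => `|star_pow n q p * a n|))) /\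
  (forall K : set H, compact K -> K `<=` Omega p r ->
     {uniform K,
       (fun N q => series (fun n => star_pow n q p * a n) N) @ \oo --> f}).

End SliceHyperholomorphic.

Arguments e1 {R}.
Arguments e2 {R}.
Arguments e3 {R}.
Arguments imag_sphere {R}.

(* Main.v *)
(* The star powers are [(q - p)^{*n} = T^n 1] for the real-linear operator [T
   x = q x - x p]. Since [T - (q0 q - q0 p)] is skew-adjoint of norm
   [`|qvec q| + `|qvec p|], the norm of [T] is [slice_radius p q], and [Omega
   p r] is exactly the set where it is less than [r]. Hence the star powers
   grow at most like [slice_radius p q ^ n], their directional derivatives
   like [n * slice_radius p q ^ n], and the second-order Taylor remainder like
   [n^2 * slice_radius p q ^ n]; summing this last estimate against [a n]
   differentiates the series term by term. Applying [Dbar] to [(q - p)^{*n}]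
   and using [e_i q = qconj q e_i - 2 q_i] gives a recursion in [n] that is
   also satisfied by [2 * n * P2 (n - 1)]. *)

Require Import Defs.
From mathcomp Require Import all_boot all_order all_algebra.
From mathcomp Require Import ring.
From mathcomp Require Import all_classical all_reals all_analysis.

Set Implicit Arguments.
Unset Strict Implicit.
Unset Printing Implicit Defensive.

Import Order.TTheory GRing.Theory Num.Theory.
Import numFieldNormedType.Exports.

Local Open Scope classical_set_scope.
Local Open Scope ring_scope.

(** * Algebra of the star powers, of their derivatives and of [Dbar] applied to them *)

Section StarPowers.
Variable R : realType.
Local Notation H := (quat R).
Implicit Types (p q v x : H) (m n k : nat).

(** Pascal's rule, in the form that turns the binomial sums of [star_pow] and [star_mul] into
    recursions. *)
Lemma sum_binS (V : nmodType) (F : nat -> nat -> V) n :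
  \sum_(0 <= i < n.+2) F i (n.+1 - i)%N *+ 'C(n.+1, i) =
  \sum_(0 <= i < n.+1) (F i.+1 (n - i)%N + F i (n - i).+1) *+ 'C(n, i).
Proof.
under [RHS]eq_bigr do rewrite mulrnDl.
rewrite [RHS]big_split /= big_nat_recl //.
under eq_bigr do rewrite binS mulrnDr subSS.
rewrite big_split /= addrA addrC; congr (_ + _).
transitivity (\sum_(0 <= i < n.+2) F i (n.+1 - i)%N *+ 'C(n, i)).
  by rewrite [RHS]big_nat_recl // bin0 bin0.
rewrite big_nat_recr //= bin_small // mulr0n addr0.
by apply: eq_big_nat => i /andP[_ lein]; rewrite subSn.
Qed.

Lemma star_pow0 q p : star_pow 0 q p = 1.
Proof. by rewrite /star_pow big_nat1 subnn !expr0 mulr1. Qed.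

Lemma star_powS n q p :
  star_pow n.+1 q p = q * star_pow n q p - star_pow n q p * p.
Proof.
rewrite /star_pow (sum_binS (fun i k => q ^+ i * (- p) ^+ k)).
rewrite -mulrN mulr_sumr mulr_suml -big_split; apply: eq_bigr => i _ /=.
by rewrite mulrnAr mulrnAl -mulrnDl mulrA -exprS -mulrA -exprSr.
Qed.

Lemma star_mul0n k q p : star_mul 0 k q p = star_pow k (qconj q) p.
Proof.
rewrite /star_mul big_nat1; apply: eq_bigr => j _.
by rewrite expr0 mul1r subnn add0n mul1n.
Qed.

Lemma star_mulSn m k q p :
  star_mul m.+1 k q p = q * star_mul m k q p - star_mul m k q p * p.
Proof.
pose F i l := \sum_(0 <= j < k.+1)
  (q ^+ i * qconj q ^+ j * (- p) ^+ (l + (k - j))) *+ 'C(k, j).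
have FE n : star_mul n k q p = \sum_(0 <= i < n.+1) F i (n - i)%N *+ 'C(n, i).
  apply: eq_bigr => i _; rewrite /F -sumrMnl.
  by apply: eq_bigr => j _; rewrite mulnC mulrnA.
rewrite !FE sum_binS -mulrN mulr_sumr mulr_suml -big_split.
apply: eq_bigr => i _ /=; rewrite mulrnAr mulrnAl -mulrnDl; congr (_ *+ _).
rewrite /F mulr_sumr mulr_suml -!big_split; apply: eq_bigr => j _ /=.
by rewrite mulrnAr mulrnAl exprS !mulrA -[_ * _ * - p]mulrA -exprSr addSn.
Qed.

Lemma qconj_comm q : qconj q * q = q * qconj q.
Proof. by case: q => a b c d; congr Quat; rewrite /=; ring. Qed.

(** In [star_mul] the powers of [q] stand to the left of those of [qconj q], so the recursion in [k]
    goes by induction on [m], with [qconj_comm]. *)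
Lemma star_mulnS m k q p : star_mul m k.+1 q p =
  qconj q * star_mul m k q p - star_mul m k q p * p.
Proof.
elim: m => [|m IH]; first by rewrite !star_mul0n star_powS.
rewrite [LHS]star_mulSn IH star_mulSn; have := qconj_comm q.
move: (qconj q) (star_mul m k q p) => c s cq.
rewrite !mulrBr !mulrBl !mulrA cq !opprB -!addrA; congr (_ + _).
by rewrite addrCA [RHS]addrCA; congr (_ + _); rewrite addrC.
Qed.

Lemma star_muln0 m q p : star_mul m 0 q p = star_pow m q p.
Proof.
elim: m => [|m IH]; first by rewrite star_mul0n !star_pow0.
by rewrite star_mulSn IH star_powS.
Qed.

(* The derivative of [star_pow n q p] with respect to [q] in the direction
   [v], from the recursion [star_powS]. *)
Fixpoint dstar v n q p : H :=
  if n is m.+1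
  then v * star_pow m q p + (q * dstar v m q p - dstar v m q p * p)
  else 0.

Lemma dstarS v n q p : dstar v n.+1 q p =
  v * star_pow n q p + (q * dstar v n q p - dstar v n q p * p).
Proof. by []. Qed.

(** Left multiplication by such a [v] commutes with [x |-> q * x - x * p], so the usual power rule
    survives. *)
Lemma dstar_comm v n q p : v * q = q * v ->
  dstar v n.+1 q p = n.+1%:R *: (v * star_pow n q p).
Proof.
move=> vq; elim: n => [|n IH].
  by rewrite dstarS mulr0 mul0r subrr addr0 scale1r.
rewrite dstarS IH.
have -> : v * star_pow n.+1 q p =
    q * (v * star_pow n q p) - v * star_pow n q p * p.
  by rewrite star_powS mulrBr !mulrA vq.
have <- : n.+1%:R + 1 = n.+2%:R :> R by rewrite natr1.
by rewrite scalerDl scale1r -scalerAr -scalerAl -scalerBr addrC.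
Qed.

Lemma dstarD v w n q p :
  dstar (v + w) n q p = dstar v n q p + dstar w n q p.
Proof.
elim: n => [|n IH]; first by rewrite addr0.
rewrite !dstarS IH mulrDl mulrDr mulrDl opprD [RHS]addrACA.
by congr (_ + _); rewrite addrACA.
Qed.

Lemma dstarZ c v n q p : dstar (c *: v) n q p = c *: dstar v n q p.
Proof.
elim: n => [|n IH]; first by rewrite scaler0.
by rewrite !dstarS IH -!scalerAl -scalerAr -scalerBr -scalerDr.
Qed.

Definition Dbar_star n q p : H :=
  dstar 1 n q p - e1 * dstar e1 n q p - e2 * dstar e2 n q p
  - e3 * dstar e3 n q p.

Lemma qvecE q : qvec q = q1 q *: e1 + q2 q *: e2 + q3 q *: e3.
Proof. by case: q => a b c d; congr Quat; rewrite /=; ring. Qed.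

(* From [e_i q = qconj q e_i - 2 q_i]. *)
Lemma Dbar_mull q (s d0 d1 d2 d3 p : H) :
  (1 * s + (q * d0 - d0 * p)) - e1 * (e1 * s + (q * d1 - d1 * p))
  - e2 * (e2 * s + (q * d2 - d2 * p)) - e3 * (e3 * s + (q * d3 - d3 * p)) =
  4 *: s
  + (qconj q * (d0 - e1 * d1 - e2 * d2 - e3 * d3)
     - (d0 - e1 * d1 - e2 * d2 - e3 * d3) * p)
  + 2 *: (qvec q * d0)
  + 2 *: (q1 q *: d1 + q2 q *: d2 + q3 q *: d3).
Proof.
case: q s d0 d1 d2 d3 p => ? ? ? ? [? ? ? ?] [? ? ? ?] [? ? ? ?] [? ? ? ?].
by move=> [? ? ? ?] [? ? ? ?]; congr Quat; rewrite /=; ring.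
Qed.

(** By linearity of [dstar] in the direction, the last terms of [Dbar_mull] add up to the derivative
    along [qvec q]. As [qvec q] commutes with [q], this is [qvec q * dstar 1 n q p]. *)
Lemma Dbar_starS n q p : Dbar_star n.+1 q p = 4 *: star_pow n q p
  + (qconj q * Dbar_star n q p - Dbar_star n q p * p)
  + 4 *: (qvec q * dstar 1 n q p).
Proof.
rewrite {1}/Dbar_star !dstarS Dbar_mull -!dstarZ -!dstarD.
rewrite -qvecE -addrA -scalerDr.
congr (_ + _); have vq : qvec q * q = q * qvec q.
  by case: q => a b c d; congr Quat; rewrite /=; ring.
have -> : dstar (qvec q) n q p = qvec q * dstar 1 n q p.
  case: n => [|n]; first by rewrite mulr0.
  by rewrite !dstar_comm ?mul1r ?mulr1 // scalerAr.
rewrite -[X in X + X]scale1r -scalerDl scalerA; congr (_ *: _); ring.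
Qed.

Lemma qconjE q : qconj q = q - 2 *: qvec q.
Proof. by case: q => a b c d; congr Quat; rewrite /=; ring. Qed.

(** In the induction, [qconj q = q - 2 *: qvec q] applied to the part [2 *: dstar 1 n q p] yields a
    term that cancels the last one of [Dbar_starS]. *)
Lemma Dbar_starE n q p : Dbar_star n q p = 2 *: dstar 1 n q p +
  2 *: \sum_(1 <= k < n.+1) star_mul (n - k) k.-1 q p.
Proof.
elim: n => [|n IH].
  by rewrite /Dbar_star !mulr0 !subr0 big_geq // !scaler0 addr0.
pose Q m := \sum_(1 <= k < m.+1) star_mul (m - k) k.-1 q p.
rewrite -/(Q n) in IH; rewrite -/(Q n.+1).
(* The term [k = 1] is a pure star power; the others come from [Q n] through [star_mulnS]. *)
have QS : Q n.+1 = star_pow n q p + (qconj q * Q n - Q n * p).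
  rewrite /Q big_nat_recl // subSS subn0 star_muln0 -mulrN; congr (_ + _).
  rewrite mulr_sumr mulr_suml -big_split big_nat_cond [RHS]big_nat_cond.
  apply: eq_bigr => -[//|k] _ /=.
  by rewrite subSS star_mulnS mulrN.
rewrite Dbar_starS IH QS dstarS qconjE.
move: (star_pow n q p) (dstar 1 n q p) (Q n) => s d t.
case: q {Q QS IH} => ? ? ? ?; case: p => ? ? ? ?.
case: s d t => [? ? ? ?] [? ? ? ?] [? ? ? ?].
by congr Quat; rewrite /=; ring.
Qed.

Lemma Dbar_star_P2 n q p :
  Dbar_star n.+1 q p = (2 * n.+1%:R) *: P2 n q p.
Proof.
rewrite Dbar_starE dstar_comm ?mul1r ?mulr1 // /P2 -scalerDr -scalerA.
by rewrite [n.+1%:R *: (_ + _)]scalerDr scalerA mulfV ?scale1r ?pnatr_eq0.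
Qed.
End StarPowers.

(** * Norm estimates for star powers, their derivatives and Taylor remainders *)

Section StarEstimates.
Variable R : realType.
Local Notation H := (quat R).
Implicit Types (p q v w x : H) (s : R) (n : nat).

Lemma quat_norm_sqr q :
  `|q| ^+ 2 = q0 q ^+ 2 + q1 q ^+ 2 + q2 q ^+ 2 + q3 q ^+ 2.
Proof. by rewrite sqr_sqrtr // !addr_ge0 // sqr_ge0. Qed.

(** Euler's four-square identity. *)
Lemma quat_normM p q : `|p * q| = `|p| * `|q|.
Proof.
apply/eqP; rewrite -(eqrXn2 (n := 2)) ?mulr_ge0 // exprMn !quat_norm_sqr.
by apply/eqP; case: p q => ? ? ? ? [? ? ? ?] /=; ring.
Qed.

(* When [p = p0 + I p1] and [q = x + J y] with [y, p1 >= 0], this is the larger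
   of the distances from [p] to [x + I y] and [x - I y]; it is the operator
   norm of [x |-> q * x - x * p], whose iterates on [1] are the star powers. *)
Definition slice_radius p q : R :=
  `|Quat (q0 q - q0 p) (`|qvec q| + `|qvec p|) 0 0|.

Lemma slice_radius_ge0 p q : 0 <= slice_radius p q.
Proof. exact: normr_ge0. Qed.

(** The map [x |-> qvec q * x - x * qvec p] is skew-adjoint, so its value is orthogonal to [x] and
    the squared norm splits without a cross term. *)
Lemma slice_radius_opnorm p q x : `|q * x - x * p| <= slice_radius p q * `|x|.
Proof.
rewrite -(ler_pXn2r (ltn0Sn 1)) ?nnegrE ?mulr_ge0 ?slice_radius_ge0 //.
have vec : `|qvec q * x - x * qvec p| <= (`|qvec q| + `|qvec p|) * `|x|.
  by rewrite (le_trans (ler_normB _ _)) // !quat_normM mulrDl [`|x| * _]mulrC.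
have -> : `|q * x - x * p| ^+ 2 =
    (q0 q - q0 p) ^+ 2 * `|x| ^+ 2 + `|qvec q * x - x * qvec p| ^+ 2.
  rewrite !quat_norm_sqr {vec}.
  by case: p q x => ? ? ? ? [? ? ? ?] [? ? ? ?] /=; ring.
rewrite exprMn [slice_radius _ _ ^+ 2]quat_norm_sqr /= expr0n /= !addr0 mulrDl.
by rewrite lerD2l -exprMn ler_pXn2r // nnegrE ?mulr_ge0 ?addr_ge0.
Qed.

Lemma norm_Quat2_le (x y z : R) : `|y| <= z ->
  `|Quat x y 0 0| <= `|Quat x z 0 0|.
Proof.
move=> yz; rewrite ler_sqrt /= expr0n /= !addr0 ?addr_ge0 ?sqr_ge0 //.
by rewrite lerD2l -[y ^+ 2]real_normK ?num_real // ler_pXn2r // nnegrE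
  (le_trans _ yz).
Qed.

(** Triangle inequality in the plane for the pairs (real part, norm of the vector part). It lets
    estimates with a radius [s] above [slice_radius p q] hold near [q] as well. *)
Lemma slice_radiusD p q v :
  slice_radius p (q + v) <= slice_radius p q + `|v|.
Proof.
have -> : `|v| = `|Quat (q0 v) `|qvec v| 0 0|.
  apply/eqP; rewrite -(eqrXn2 (n := 2)) // !quat_norm_sqr /=.
  by rewrite ?quat_norm_sqr /=; apply/eqP; ring.
apply: le_trans (ler_normD _ _).
have -> : Quat (q0 q - q0 p) (`|qvec q| + `|qvec p|) 0 0
  + Quat (q0 v) `|qvec v| 0 0 =
  Quat (q0 (q + v) - q0 p) (`|qvec q| + `|qvec p| + `|qvec v|) 0 0.
  by congr Quat; rewrite /=; ring.
apply: norm_Quat2_le; rewrite ger0_norm ?addr_ge0 // addrAC lerD2r.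
have -> : qvec (q + v) = qvec q + qvec v.
  by congr Quat; rewrite /=; ring.
exact: ler_normD.
Qed.

Section Bounds.
Variables (s : R) (p q : H).
Hypotheses (s0 : 0 <= s) (qs : slice_radius p q <= s).

Let opnorm x : `|q * x - x * p| <= s * `|x|.
Proof. by rewrite (le_trans (slice_radius_opnorm _ _ _)) // ler_wpM2r. Qed.

Lemma star_pow_norm n : `|star_pow n q p| <= s ^+ n.
Proof.
elim: n => [|n IH].
  rewrite star_pow0 expr0 /Num.norm /= /quat_norm /= expr0n /= expr1n !addr0.
  by rewrite sqrtr1.
by rewrite star_powS exprS (le_trans (opnorm _)) // ler_wpM2l.
Qed.

(* Derivatives, increments and Taylor remainders of the star powers all obey a
   recursion [x_(n+1) = v * y_n + T x_n]; the factor [s] avoids the truncated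
   exponent [n - 1]. *)
Lemma star_recur_norm v x y (c d : R) : `|y| <= c -> `|x| * s <= d ->
  `|v * y + (q * x - x * p)| * s <= `|v| * c * s + s * d.
Proof.
move=> yc xd; apply: le_trans (ler_wpM2r s0 (ler_normD _ _)) _.
rewrite mulrDl quat_normM lerD //; first by rewrite ler_wpM2r // ler_wpM2l.
by apply: le_trans (ler_wpM2r s0 (opnorm x)) _; rewrite -mulrA ler_wpM2l.
Qed.

Lemma dstar_norm v n : `|dstar v n q p| * s <= n%:R * `|v| * s ^+ n.
Proof.
elim: n => [|n IH]; first by rewrite normr0 !mul0r.
rewrite dstarS (le_trans (star_recur_norm v (star_pow_norm n) IH)) //.
by rewrite le_eqVlt -natr1 exprS; apply/orP; left; apply/eqP; ring.
Qed.

End Bounds.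

Lemma star_powBS p q w n :
  star_pow n.+1 (q + w) p - star_pow n.+1 q p =
  w * star_pow n (q + w) p +
  (q * (star_pow n (q + w) p - star_pow n q p)
   - (star_pow n (q + w) p - star_pow n q p) * p).
Proof.
rewrite !star_powS; move: (star_pow n (q + w) p) (star_pow n q p) => x y.
case: p q w x y => ? ? ? ? [? ? ? ?] [? ? ? ?] [? ? ? ?] [? ? ? ?].
by congr Quat; rewrite /=; ring.
Qed.

Section Increments.
Variables (s : R) (p q w : H).
Hypotheses (s0 : 0 <= s).
Hypotheses (qs : slice_radius p q <= s) (qws : slice_radius p (q + w) <= s).

Lemma star_pow_lip n :
  `|star_pow n (q + w) p - star_pow n q p| * s <= n%:R * `|w| * s ^+ n.
Proof.
elim: n => [|n IH]; first by rewrite !star_pow0 subrr normr0 !mul0r.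
rewrite star_powBS.
apply: le_trans (star_recur_norm s0 qs w (star_pow_norm s0 qws n) IH) _.
by rewrite le_eqVlt -natr1 exprS; apply/orP; left; apply/eqP; ring.
Qed.

(** The remainder obeys the same recursion, driven by [w] times the increment, which [star_pow_lip]
    controls. *)
Lemma star_pow_taylor n :
  `|star_pow n (q + w) p - star_pow n q p - dstar w n q p| * s ^+ 2
  <= n%:R ^+ 2 * `|w| ^+ 2 * s ^+ n.
Proof.
elim: n => [|n IH].
  by rewrite !star_pow0 subrr subr0 normr0 expr0n /= !mul0r.
move: (star_pow_lip n) IH; rewrite star_powBS dstarS.
move: (star_pow n (q + w) p) (star_pow n q p) (dstar w n q p) => x y d xy IH.
rewrite (_ : _ - _ = w * (x - y) + (q * (x - y - d) - (x - y - d) * p));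
  last first.
  by move: (p) (q) (w) (x) (y) (d) => [? ? ? ?] [? ? ? ?] [? ? ? ?]
    [? ? ? ?] [? ? ? ?] [? ? ? ?]; congr Quat; rewrite /=; ring.
rewrite expr2 mulrA.
have := star_recur_norm s0 qs w (lexx `|x - y|) (lexx (`|x - y - d| * s)).
move=> /(ler_wpM2r s0)/le_trans; apply.
have A := ler_wpM2l (mulr_ge0 (normr_ge0 w) s0) xy.
have B := ler_wpM2l s0 IH.
have C : 0 <= n.+1%:R * `|w| ^+ 2 * s ^+ n.+1 by rewrite !mulr_ge0 ?exprn_ge0.
(* The bounds [A] and [B] add up with the coefficient [n + n^2 = (n+1)^2 - (n+1)]. *)
apply: le_trans (_ : n.+1%:R ^+ 2 * `|w| ^+ 2 * s ^+ n.+1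
  - n.+1%:R * `|w| ^+ 2 * s ^+ n.+1 <= _); last by rewrite gerBl.
apply: le_trans (le_trans (lerD A B) _); rewrite le_eqVlt; apply/orP; left.
  by apply/eqP; ring.
by rewrite -natr1 !exprS; apply/eqP; ring.
Qed.

End Increments.
End StarEstimates.

(** * [Omega p r] as a sublevel set of [slice_radius p] *)

Section OmegaRadius.
Variable R : realType.
Local Notation H := (quat R).
Implicit Types (p q I J : H) (r : \bar R).

Lemma norm_slice I (x y : R) : imag_sphere I ->
  `|x%:A + y *: I| = `|Quat x y 0 0|.
Proof.
move=> [I0 I1]; apply/eqP; rewrite -(eqrXn2 (n := 2)) // !quat_norm_sqr /=.
have := quat_norm_sqr I; rewrite I0 I1 => N.
apply/eqP; transitivity (x ^+ 2 +
  y ^+ 2 * (0 ^+ 2 + q1 I ^+ 2 + q2 I ^+ 2 + q3 I ^+ 2)).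
  by ring.
by rewrite -N; ring.
Qed.

Lemma imag_sphere_repr q :
  exists2 I, imag_sphere I & q = (q0 q)%:A + `|qvec q| *: I.
Proof.
have [v0|v0] := eqVneq (qvec q) 0.
  (* A real [q] lies in every slice; [e1] is an arbitrary choice. *)
  exists e1; last first.
    by rewrite v0 normr0 scale0r addr0; case: q v0 => a b c d [-> -> ->];
       congr Quat; rewrite /=; ring.
  split=> //; apply/eqP; rewrite -(eqrXn2 (n := 2)) // quat_norm_sqr /=.
  by apply/eqP; ring.
exists (`|qvec q|^-1 *: qvec q).
  split; first by rewrite /= mulr0.
  by rewrite normrZ normfV normr_id mulVf // normr_eq0.
rewrite scalerA divff ?normr_eq0 // scale1r.
by case: q {v0} => a b c d; congr Quat; rewrite /=; ring.
Qed.

Lemma qvec_slice I (x y : R) : imag_sphere I ->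
  q0 (x%:A + y *: I) = x /\ `|qvec (x%:A + y *: I)| = `|y|.
Proof.
move=> [I0 I1]; split; first by rewrite /= I0 mulr1 mulr0 addr0.
rewrite -[RHS]mulr1 -I1 -normrZ; congr `|_|.
by case: I I0 {I1} => a b c d /= ->; congr Quat; rewrite /=; ring.
Qed.

Lemma slice_sub I (x y x' y' : R) :
  x%:A + y *: I - (x'%:A + y' *: I) = (x - x')%:A + (y - y') *: I.
Proof. by rewrite opprD addrACA !scalerBl. Qed.

Lemma OmegaP p q r : Omega p r q <-> ((slice_radius p q)%:E < r)%E.
Proof.
split.
  move=> [I [J [x [y [[SI [x' [y' ->]]] SJ -> [_ +] [_]]]]]].
  rewrite -[_ - y *: I]/(_ + - (y *: I)) -scaleNr !slice_sub !norm_slice //.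
  rewrite /slice_radius.
  have [-> ->] := qvec_slice x y SJ; have [-> ->] := qvec_slice x' y' SI.
  move=> A B; set z := Quat _ (_ + _) 0 0.
  suff [->|->] : `|z| = `|Quat (x - x') (y - y') 0 0| \/
    `|z| = `|Quat (x - x') (- y - y') 0 0| by [].
  (* The sign of [y * y'] decides which of the points [x - y I] and [x + y I] is the farther from
     [p], at distance [slice_radius p q]. *)
  have [yy|yy] := lerP 0 (y * y'); [right|left];
    apply/eqP; rewrite -(eqrXn2 (n := 2)) // !quat_norm_sqr /=; apply/eqP;
    congr (_ + _ + _ + _);
    rewrite !sqrrD -normrM !real_normK ?num_real //.
    by rewrite ger0_norm //; ring.
  by rewrite ltr0_norm //; ring.
have [I SI pE] := imag_sphere_repr p; have [J SJ qE] := imag_sphere_repr q.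
(* With the polar forms of [p] and [q], both distances are at most [slice_radius p q]. *)
move=> lr; exists I, J, (q0 q), `|qvec q|; split => //; split.
- exact: SI.
- by exists (q0 p), `|qvec p|.
- by exists (q0 q), `|qvec q|.
- rewrite {1}pE slice_sub norm_slice //; apply: le_lt_trans lr.
  rewrite lee_fin norm_Quat2_le // (le_trans (ler_normB _ _)) //.
  by rewrite ?normrN !normr_id.
- by exists (q0 q), (- `|qvec q|); rewrite scaleNr.
- rewrite -scaleNr {1}pE slice_sub norm_slice //; apply: le_lt_trans lr.
  rewrite lee_fin norm_Quat2_le // (le_trans (ler_normB _ _)) //.
  by rewrite ?normrN !normr_id.
Qed.
End OmegaRadius.

(** * Convergence of dominated quaternionic series *)

Section Series.
Variable R : realType.
Local Notation H := (quat R).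

Lemma quat_norm_le_sum (q : H) :
  `|q| <= `|q0 q| + `|q1 q| + `|q2 q| + `|q3 q|.
Proof.
rewrite -(ler_pXn2r (ltn0Sn 1)) ?nnegrE ?addr_ge0 // quat_norm_sqr.
rewrite -[q0 q ^+ 2]real_normK ?num_real // -[q1 q ^+ 2]real_normK ?num_real //.
rewrite -[q2 q ^+ 2]real_normK ?num_real // -[q3 q ^+ 2]real_normK ?num_real //.
move: (normr_ge0 (q0 q)) (normr_ge0 (q1 q)).
move: (normr_ge0 (q2 q)) (normr_ge0 (q3 q)).
move: `|q0 q| `|q1 q| `|q2 q| `|q3 q| => a b c d c0 d0 a0 b0.
rewrite -subr_ge0 (_ : _ - _ =
  2 * (a * b + a * c + a * d + b * c + b * d + c * d)); last by ring.
by rewrite mulr_ge0 // !addr_ge0 // mulr_ge0.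
Qed.

Lemma quat_coord_le (q : H) : [/\ `|q0 q| <= `|q|, `|q1 q| <= `|q|,
  `|q2 q| <= `|q| & `|q3 q| <= `|q|].
Proof.
split; rewrite -[leLHS]sqrtr_sqr ler_sqrt ?addr_ge0 ?sqr_ge0 //.
- by rewrite -!addrA lerDl !addr_ge0 ?sqr_ge0.
- by rewrite [X in _ <= X + _ + _]addrC -!addrA lerDl !addr_ge0 ?sqr_ge0.
- by rewrite addrAC lerDr !addr_ge0 ?sqr_ge0.
- by rewrite lerDr !addr_ge0 ?sqr_ge0.
Qed.

Lemma quat_cvg (T : Type) (F : set_system T) (u : T -> H) (l : H) : Filter F ->
  q0 (u x) @[x --> F] --> q0 l -> q1 (u x) @[x --> F] --> q1 l ->
  q2 (u x) @[x --> F] --> q2 l -> q3 (u x) @[x --> F] --> q3 l ->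
  u x @[x --> F] --> l.
Proof.
move=> FF c0 c1 c2 c3; apply/subr_cvg0/norm_cvg0P.
apply: (@squeeze_cvgr _ _ _ _ (cst 0) (fun x => `|q0 (u x) - q0 l|
  + `|q1 (u x) - q1 l| + `|q2 (u x) - q2 l| + `|q3 (u x) - q3 l|)).
- apply: nearW => x /=; rewrite normr_ge0 /=.
  exact: (quat_norm_le_sum (u x - l)).
- exact: cvg_cst.
have N (g : T -> R) (a : R) : g x @[x --> F] --> a ->
    `|g x - a| @[x --> F] --> (0 : R).
  by move=> ga; apply/norm_cvg0P/subr_cvg0.
have := cvgD (cvgD (cvgD (N _ _ c0) (N _ _ c1)) (N _ _ c2)) (N _ _ c3);
by rewrite !addr0; apply.
Qed.

(* [quat R] is not declared complete, so this goes through coordinates. *)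
Lemma quat_normed_cvg (u : nat -> H) (v : nat -> R) :
  (forall n, `|u n| <= v n) -> cvgn (series v) ->
  exists2 l, series u @ \oo --> l & `|l| <= limn (series v).
Proof.
move=> uv cv.
have v0 n : 0 <= v n by exact: le_trans (uv n).
(* Each coordinate is additive and bounded by the norm, so its series converges absolutely by
   comparison with [v]. *)
have coord (f : H -> R) : (forall q, `|f q| <= `|q|) ->
    {morph f : x y / x + y} -> f 0 = 0 ->
    f (series u n) @[n --> \oo] --> limn (series (f \o u)).
  move=> fle fD f0.
  rewrite (_ : (fun n => f (series u n)) = series (f \o u)); last first.
    by apply/funext => n; exact: big_morph.
  apply: (@normed_cvg _ R^o); apply: series_le_cvg cv => // n.
    exact: normr_ge0.
  exact: le_trans (fle _) (uv n).
pose l := Quat (limn (series (@q0 R \o u))) (limn (series (@q1 R \o u)))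
  (limn (series (@q2 R \o u))) (limn (series (@q3 R \o u))).
have ul : series u @ \oo --> l.
  by apply: quat_cvg; apply: coord => // q; case: (quat_coord_le q).
exists l => //; apply: cvgr_to_le (cvg_norm ul) _.
apply: nearW => n; apply: le_trans (ler_norm_sum _ _ _) _.
apply: le_trans (ler_sum _ (fun i _ => uv i)) _.
exact: (nondecreasing_cvgn_le (nondecreasing_series (fun i _ _ => v0 i)) cv n).
Qed.

Lemma cvg_mull (T : Type) (F : set_system T) (u : T -> H) (c l : H) :
  Filter F -> u @ F --> l -> (c * u x) @[x --> F] --> c * l.
Proof.
move=> FF ul; have {}ul : `|u x - l| @[x --> F] --> (0 : R).
  by apply/norm_cvg0P/subr_cvg0.
apply/subr_cvg0/norm_cvg0P.
under eq_fun do rewrite -mulrBr quat_normM.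
by rewrite -(mulr0 `|c|); exact: cvgM (cvg_cst _) ul.
Qed.

End Series.

(** * Root test and power series with quadratic weights *)

Section PowerSeries.
Variable R : realType.
Implicit Types (c : nat -> R) (s t : R) (r : \bar R).

Lemma limn_esup_ltP (u : nat -> \bar R) (y : \bar R) : (limn_esup u < y)%E ->
  exists N, forall n, (N <= n)%N -> (u n < y)%E.
Proof.
move=> /ereal_inf_lt[_ [A [N _ NA] <-]] lt; exists N => n Nn.
apply: le_lt_trans lt; apply: ereal_sup_ubound; exists n => //; exact: NA.
Qed.

Lemma root_test_bound c t r : (forall n, 0 <= c n) ->
  0 < t -> (t%:E < r)%E -> (0 < r)%E ->
  r^-1%E = limn_esup (fun n => (c n `^ n%:R^-1)%:E) ->
  exists C, forall n, c n * t ^+ n <= C.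
Proof.
move=> c0 t0 tr r0 rE.
have : (limn_esup (fun n => (c n `^ n%:R^-1)%:E) < t^-1%:E)%E.
  rewrite -rE; case: r tr r0 {rE} => [x| |//].
    by rewrite !lte_fin => tx x0; rewrite inver gt_eqF // lte_fin ltf_pV2.
  by rewrite invey lte_fin invr_gt0.
move=> /limn_esup_ltP[N uN].
(* The bound 1 serves the tail, the sum the first terms. The sum includes index [N], so [n] is
   positive in the tail and the root there is genuine ([0%:R^-1] is 0). *)
exists (1 + \sum_(0 <= i < N.+1) c i * t ^+ i) => n.
have S0 k : 0 <= \sum_(0 <= i < k) c i * t ^+ i.
  by rewrite sumr_ge0 // => i _; rewrite mulr_ge0 // exprn_ge0 // ltW.
have [nN|Nn] := ltnP n N.+1.
  rewrite big_mkord (bigD1 (Ordinal nN)) //= addrCA lerDl.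
  rewrite addr_ge0 // sumr_ge0 // => i _.
  by rewrite mulr_ge0 // exprn_ge0 // ltW.
apply: le_trans (_ : 1 <= _); last by rewrite lerDl.
have := uN n (ltnW Nn); rewrite lte_fin => /ltW un.
have cE : c n = (c n `^ n%:R^-1) ^+ n.
  rewrite -powR_mulrn ?powR_ge0 // -powRrM mulVf ?powRr1 //.
  by rewrite pnatr_eq0 -lt0n (leq_trans _ Nn).
rewrite cE -exprMn exprn_ile1 ?mulr_ge0 ?powR_ge0 ?(ltW t0) //.
by rewrite -ler_pdivlMr // div1r.
Qed.

Lemma bernoulli_le (d : R) n : 0 <= d -> n%:R * d <= (1 + d) ^+ n.
Proof.
move=> d0; elim: n => [|n IH]; first by rewrite mul0r expr0.
rewrite exprS mulrDl mul1r -natr1 mulrDl mul1r lerD //.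
by rewrite ler_peMr // exprn_ege1 // lerDl.
Qed.

(** With [y^4 = t / s > 1], Bernoulli gives [n <= y^n / (y - 1)]. Hence [n^2] costs a factor
    [y^(2n)] while [s^n = y^(-4n) t^n], and a geometric series of ratio [y^(-2)] dominates. *)
Lemma sqr_power_series_cvg c s t C : (forall n, 0 <= c n) -> 0 < s -> s < t ->
  (forall n, c n * t ^+ n <= C) ->
  cvgn (series (fun n => n%:R ^+ 2 * s ^+ n * c n)).
Proof.
move=> c0 s0 st cC.
have t0 := lt_trans s0 st.
pose y := Num.sqrt (Num.sqrt (t / s)).
have sqrt_gt1 (z : R) : 1 < z -> 1 < Num.sqrt z.
  by move=> z1; rewrite -[ltLHS]sqrtr1 ltr_sqrt // (lt_trans _ z1).
have y1 : 1 < y by rewrite !sqrt_gt1 // ltr_pdivlMr // mul1r.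
have y4 : y ^+ 4 = t / s.
  by rewrite (exprM y 2 2) sqr_sqrtr ?sqrtr_ge0 // sqr_sqrtr ?divr_ge0 // ltW.
have y0 : 0 < y by exact: lt_trans y1.
have d0 : 0 < y - 1 by rewrite subr_gt0.
apply: (@series_le_cvg _ _ (geometric ((y - 1) ^- 2 * C) (y ^- 2))).
- by move=> n; rewrite !mulr_ge0 ?exprn_ge0 // ltW.
- have C0 : 0 <= C by rewrite (le_trans _ (cC 0)) // mulr1.
  by move=> n /=; rewrite !mulr_ge0 // ?exprn_ge0 ?invr_ge0 ?exprn_ge0 // ltW.
- move=> n /=.
  have B : n%:R <= (y - 1)^-1 * y ^+ n.
    rewrite ler_pdivlMl // mulrC.
    by have := bernoulli_le n (ltW d0); rewrite [1 + _]addrC subrK.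
  have B2 : n%:R ^+ 2 <= (y - 1) ^- 2 * (y ^+ n) ^+ 2.
    rewrite -exprVn -exprMn ler_pXn2r // nnegrE //.
    by rewrite mulr_ge0 ?invr_ge0 ?exprn_ge0 // ltW.
  have E : s ^+ n = (y ^- 4) ^+ n * t ^+ n.
    by rewrite -exprMn y4 invf_div divfK // gt_eqF.
  rewrite E -mulrA -[_ * c n]mulrA [t ^+ n * _]mulrC.
  have Y : 0 <= y ^- 4 ^+ n by rewrite exprn_ge0 // invr_ge0 exprn_ge0 // ltW.
  apply: le_trans (ler_pM _ _ B2 (ler_wpM2l Y (cC n))) _ => //.
    by rewrite mulr_ge0 // mulr_ge0 // exprn_ge0 // ltW.
  have <- : (y ^+ n) ^+ 2 * y ^- 4 ^+ n = y ^- 2 ^+ n.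
    rewrite exprAC -exprMn; congr (_ ^+ n).
    by field; rewrite gt_eqF.
  by rewrite le_eqVlt; apply/orP; left; apply/eqP; ring.
apply: is_cvg_geometric_series.
rewrite ger0_norm ?invr_ge0 ?exprn_ge0 ?(ltW y0) //.
by rewrite invf_lt1 ?exprn_gt0 // exprn_egt1.
Qed.

End PowerSeries.

(** * Termwise differentiation of the star series *)

Section Differentiation.
Variable R : realType.
Local Notation H := (quat R).
Implicit Types (p q v : H) (s : R) (a : nat -> H).

(** The Taylor remainders of the terms sum to a remainder of [f] of size at most [|h|^2 * B], so the
    difference quotient differs from [G] by at most [|h| * B]. *)
Lemma star_series_is_derive (f : H -> H) p q v s a :
  cvgn (series (fun n => n%:R ^+ 2 * s ^+ n * `|a n|)) ->
  slice_radius p q < s ->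
  (forall x, slice_radius p x < s ->
    series (fun n => star_pow n x p * a n) @ \oo --> f x) ->
  exists2 G, series (fun n => dstar v n q p * a n) @ \oo --> G &
    is_derive q v f G.
Proof.
move=> cK qs fE; set K := fun n => _ in cK.
have s0 : 0 < s := le_lt_trans (slice_radius_ge0 p q) qs.
(* Since [n <= n^2], the series [K] also dominates the first derivatives. *)
have dK n : `|dstar v n q p * a n| <= (`|v| / s * K n).
  rewrite quat_normM /K mulrA ler_wpM2r // mulrAC mulrA ler_pdivlMr //.
  apply: le_trans (dstar_norm (ltW s0) (ltW qs) v n) _.
  rewrite -mulrA [leLHS]mulrCA -!mulrA ler_wpM2l //.
  rewrite [leRHS]mulrA ler_wpM2r ?exprn_ge0 ?(ltW s0) //.
  by rewrite -natrM ler_nat; case: (n) => // k; rewrite leq_pmulr.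
have [G dG _] := quat_normed_cvg dK (is_cvg_seriesZ cK).
exists G => //.
pose B := `|v| ^+ 2 / s ^+ 2 * limn (series K).
have fB (h : R) : slice_radius p (q + h *: v) < s ->
    `|f (q + h *: v) - f q - h *: G| <= `|h| ^+ 2 * B.
  move=> qhs.
  pose E n := star_pow n (q + h *: v) p - star_pow n q p - dstar (h *: v) n q p.
  have EK n : `|E n * a n| <= `|h *: v| ^+ 2 / s ^+ 2 * K n.
    rewrite quat_normM /K [leRHS]mulrA ler_wpM2r // mulrAC.
    rewrite ler_pdivlMr ?exprn_gt0 //.
    apply: le_trans (star_pow_taylor (ltW s0) (ltW qs) (ltW qhs) n) _.
    by rewrite le_eqVlt; apply/orP; left; apply/eqP; ring.
  have [l El lK] := quat_normed_cvg EK (is_cvg_seriesZ cK).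
  have -> : f (q + h *: v) - f q - h *: G = l.
    apply: (cvg_unique (@norm_hausdorff _ _) _ El).
    rewrite (_ : (fun n => E n * a n) =
      (fun n => star_pow n (q + h *: v) p * a n)
      - (fun n => star_pow n q p * a n)
      - h *: (fun n => dstar v n q p * a n)); last first.
      by apply/funext => n; rewrite /E !mulrBl dstarZ -scalerAl.
    rewrite !(seriesD, seriesN) seriesZ.
    by apply: cvgB; [apply: cvgB; exact: fE | exact: cvgZl_tmp].
  apply: le_trans lK _; rewrite lim_seriesZ // normrZ exprMn /B.
  rewrite le_eqVlt; apply/orP; left; apply/eqP.
  by rewrite /GRing.scale /=; ring.
suff dfG : (fun h => h^-1 *: ((f \o shift q) (h *: v) - f q)) @ 0^' --> G.
  by apply: DeriveDef; [apply/cvg_ex; exists G | exact: cvg_lim].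
apply/subr_cvg0/norm_cvg0P.
apply: (@squeeze_cvgr _ _ _ _ (cst 0) (fun h => `|h| * B)).
(* For [|h| < e] the point [q + h *: v] stays where the series represents [f]; the added 1 covers
   [v = 0]. *)
- pose e := (s - slice_radius p q) / (`|v| + 1).
  have v1 : 0 < `|v| + 1 by rewrite ltr_wpDl.
  have e0 : 0 < e by rewrite divr_gt0 // subr_gt0.
  near=> h; rewrite normr_ge0 /=.
  have h0 : h != 0 by near: h; exact: nbhs_dnbhs_neq.
  have he : `|h| < e by near: h; exact: dnbhs0_lt.
  have qhs : slice_radius p (q + h *: v) < s.
    apply: le_lt_trans (slice_radiusD _ _ _) _.
    rewrite -ltrBrDl normrZ; move: he; rewrite ltr_pdivlMr //.
    apply: le_lt_trans.
    by rewrite ler_wpM2l // lerDl.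
  have -> : h^-1 *: (f (h *: v + q) - f q) - G
      = h^-1 *: (f (q + h *: v) - f q - h *: G).
    by rewrite [RHS]scalerBr scalerA mulVf // scale1r [h *: v + q]addrC.
  rewrite normrZ normfV ler_pdivrMl ?normr_gt0 // mulrA -expr2; exact: fB.
- exact: cvg_cst.
- have h0 : `|h| @[h --> (0 : R)^'] --> (0 : R).
    by apply/(norm_cvg0P (fun h : R => h)); exact: nbhs_dnbhs.
  by have := cvgM h0 (cvg_cst B); rewrite mul0r; apply.
Unshelve. all: by end_near.
Qed.

End Differentiation.

(** * [Dbar] applied to the star-Taylor series *)

Theorem theorem9p6 (R : realType) (U : set (quat R)) (f : quat R -> quat R)
    (p : quat R) (a : nat -> quat R) (r : \bar R) :
  open U -> axially_symmetric U ->
  left_slice_hyperholomorphic U f ->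
  U p ->
  (0 < r)%E ->
  (r^-1)%E = limn_esup (fun n => (`|a n| `^ n%:R^-1)%:E) ->
  Omega p r `<=` U ->
  star_taylor_expansion f p r a ->
  let b := fun n : nat => (2 * n.+1%:R) *: a n.+1 in
  forall q, Omega p r q ->
    has_partials f q /\
    series (fun n => P2 n q p * b n) @ \oo --> Dbar f q.
Proof.
move=> _ _ _ _ r0 rE _ [_ fK] b q /OmegaP qr.
have between (x : R) : (x%:E < r)%E -> exists2 y, x < y & (y%:E < r)%E.
  case: r {r0 rE fK qr} => [z|_|//]; last first.
    by exists (x + 1); rewrite ?ltry ?ltrDl.
  rewrite lte_fin => /midf_lt[xz zx].
  by exists ((x + z) / 2); rewrite ?lte_fin.
(* Two radii: the root test bounds [|a n| * t^n], and [s < t] leaves room for the weight [n^2],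
   while [slice_radius p q < s] leaves room around [q]. *)
have [s qs /between[t st tr]] := between _ qr.
have s0 : 0 < s := le_lt_trans (slice_radius_ge0 p q) qs.
have a0 n : 0 <= `|a n| by exact: normr_ge0.
have [C aC] := root_test_bound a0 (lt_trans s0 st) tr r0 rE.
have cK := sqr_power_series_cvg a0 s0 st aC.
(* Uniform convergence on a singleton is convergence at its point. *)
have fE x : slice_radius p x < s ->
    series (fun n => star_pow n x p * a n) @ \oo --> f x.
  move=> xs; have := fK [set x] (@compact_set1 _ x).
  rewrite uniform_set1; apply => _ ->; apply/OmegaP.
  by apply: lt_trans tr; rewrite lte_fin (lt_trans xs).
have D v := star_series_is_derive v cK qs fE.
have [G0 c0 d0] := D 1; have [G1 c1 d1] := D e1.
have [G2 c2 d2] := D e2; have [G3 c3 d3] := D e3.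
split; first by split; apply: ex_derive.
rewrite /Dbar !derive_val.
(* [Dbar_star 0] vanishes and [Dbar_star n.+1] matches [P2 n] with the factor of [b n], so the
   partial sums agree after an index shift by one. *)
rewrite -[X in X @ _](_ :
  [sequence series (fun n => Dbar_star n q p * a n) n.+1]_n = _).
  rewrite cvg_shiftS.
  have -> : series (fun n => Dbar_star n q p * a n) =
      (fun n => series (fun n => dstar 1 n q p * a n) n
        - e1 * series (fun n => dstar e1 n q p * a n) n
        - e2 * series (fun n => dstar e2 n q p * a n) n
        - e3 * series (fun n => dstar e3 n q p * a n) n).
    apply/funext => n; rewrite /series /= !mulr_sumr -!sumrB.
    by apply: eq_bigr => i _; rewrite /Dbar_star !mulrBl !mulrA.
  by apply: cvgB (cvg_mull _ c3); apply: cvgB (cvg_mull _ c2);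
    apply: cvgB (cvg_mull _ c1).
apply/funext => n; rewrite /= /series /= big_nat_recl //.
have -> : Dbar_star 0 q p = 0 by rewrite /Dbar_star /= !mulr0 !subr0.
rewrite mul0r add0r.
by apply: eq_bigr => i _; rewrite Dbar_star_P2 -scalerAl -scalerAr.
Qed.
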